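(* Assume $a>0$ with $a\neq 1$, and let $b>0$. A Galileo function $f$ (with parameters $a,b$) must satisfy $$f(x)=g(\log_a x)\,x^{\log_a(b/a)}\qquad (x>0),$$ for some continuous function $g:\mathbb{R}\to[0,\infty)$ of period $1$. Conversely, any function of this form is a Galileo function (with parameters $a,b$).
   Context: For $a>0$ with $a\neq 1$ and $b>0$, a continuous function $f:[0,\infty)\to[0,\infty)$ is called a Galileo function (with parameters $a,b$) if $\int_0^{ax} f(t)\,dt=b\int_0^x f(t)\,dt$ for all positive real $x$. Here $\log_a$ is the real logarithm to base $a$, and $g$ of period $1$ means $g(y+1)=g(y)$ for all $y\in\mathbb{R}$.
   Formalization: In the converse, f is also assumed to be right-continuous at 0; without this it fails, e.g. a=2, b=1, g=1 gives f(x)=1/x for x>0, which is not continuous or integrable at 0. *)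

(* Defs.v *)
(* Stdlib reals with Coquelicot. *)
From Stdlib Require Import Reals.
From Coquelicot Require Import Coquelicot.
Open Scope R_scope.

(* A function [0,oo) -> [0,oo) is encoded as f : R -> R whose values at
   negative arguments are irrelevant: [continuous_on] is relative to [0,oo),
   hence one-sided at 0, and the integrals below only see f on [0,oo), where
   continuity makes the total operator [RInt] a genuine Riemann integral. *)
Definition Galileo (a b : R) (f : R -> R) : Prop :=
  (forall x, 0 <= x -> 0 <= f x) /\
  continuous_on (fun x => 0 <= x) f /\
  (forall x, 0 < x -> RInt f 0 (a * x) = b * RInt f 0 x).

Definition Galileo_form (a b : R) (f : R -> R) : Prop :=
  exists g : R -> R,
    (forall y, 0 <= g y) /\
    (forall y, continuous g y) /\
    (forall y, g (y + 1) = g y) /\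
    (forall x, 0 < x -> f x = g (Rlog a x) * Rpower x (Rlog a (b / a))).

(* Main.v *)
(* Differentiating the integral equation gives [a * f (a * x) = b * f x] for
   [x > 0]; conversely this scaling relation integrates back by the
   substitution [t = a * s].  It says that [f (a ^ y) * a ^ (- c * y)], with
   [a ^ c = b / a], has period 1 in [y]. *)
Require Import Defs.
From Stdlib Require Import Reals Lra.
From Coquelicot Require Import Coquelicot.
Open Scope R_scope.

(* Constant extension to the left of 0 makes two-sided calculus available. *)
Definition extend0 (f : R -> R) (t : R) : R := f (Rmax 0 t).

Lemma extend0_pos (f : R -> R) (x : R) : 0 <= x -> extend0 f x = f x.
Proof. intros Hx. unfold extend0. now rewrite Rmax_right. Qed.

Lemma continuous_extend0 (f : R -> R) :
  continuous_on (fun x => 0 <= x) f -> forall x, continuous (extend0 f) x.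
Proof.
  intros Hf x.
  refine (filterlim_comp _ _ _ (Rmax 0) f _ _ _ _ (Hf _ (Rmax_l 0 x))).
  (* [Rmax 0] is 1-Lipschitz, so the radius [e] can be kept; the case analysis below checks this. *)
  intros P [e He]. exists e. intros y Hy.
  apply He; [| apply Rmax_l].
  revert Hy. unfold ball; simpl; unfold AbsRing_ball, abs, minus, plus, opp; simpl.
  unfold Rmax, Rabs.
  destruct (Rle_dec 0 x), (Rle_dec 0 y); repeat destruct Rcase_abs; lra.
Qed.

Lemma RInt_extend0 (f : R -> R) (x : R) :
  0 <= x -> RInt f 0 x = RInt (extend0 f) 0 x.
Proof.
  intros Hx. apply RInt_ext. intros t.
  rewrite Rmin_left, Rmax_right by assumption. intros [H _].
  symmetry. apply extend0_pos. lra.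
Qed.

Lemma is_derive_RInt_extend0 (f : R -> R) (x : R) :
  continuous_on (fun x => 0 <= x) f ->
  is_derive (RInt (extend0 f) 0) x (extend0 f x).
Proof.
  intros Hf. pose proof (continuous_extend0 f Hf) as Hc.
  apply (is_derive_RInt (extend0 f) _ 0); [| apply Hc].
  apply filter_forall. intros y. apply (@RInt_correct R_CompleteNormedModule).
  apply (@ex_RInt_continuous R_CompleteNormedModule). intros z _. apply Hc.
Qed.

(** Both directions of the theorem pass through this equivalence, which trades the integrals for a
    pointwise relation that can be compared with the explicit form. *)
Lemma RInt_dilation_iff (a b : R) (f : R -> R) :
  0 < a -> continuous_on (fun x => 0 <= x) f ->
  (forall x, 0 < x -> RInt f 0 (a * x) = b * RInt f 0 x) <->
  (forall x, 0 < x -> a * f (a * x) = b * f x).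
Proof.
  intros ha Hf. split; intros H x Hx.
  - assert (Hax : 0 < a * x) by now apply Rmult_lt_0_compat.
    rewrite <- (extend0_pos f x), <- (extend0_pos f (a * x)) by lra.
    assert (D1 : is_derive (fun t => RInt (extend0 f) 0 (a * t)) x
                   (a * extend0 f (a * x))).
    { apply (is_derive_comp (RInt (extend0 f) 0) (fun t => a * t)).
      - now apply is_derive_RInt_extend0.
      - auto_derive; trivial; ring. }
    assert (D2 : is_derive (fun t => b * RInt (extend0 f) 0 t) x
                   (b * extend0 f x)).
    { apply is_derive_scal. now apply is_derive_RInt_extend0. }
    rewrite <- (is_derive_unique _ _ _ D1), <- (is_derive_unique _ _ _ D2).
    (* The two functions are known to agree only at positive arguments; these form a neighbourhood
       of [x], which is enough for equal derivatives. *)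
    apply Derive_ext_loc. apply (filter_imp (fun t => 0 < t)).
    + intros t Ht.
      rewrite <- !RInt_extend0; [now apply H | lra |].
      apply Rlt_le. now apply Rmult_lt_0_compat.
    + apply (open_gt 0 x Hx).
  - assert (Hc := continuous_extend0 f Hf).
    assert (Hax : 0 < a * x) by now apply Rmult_lt_0_compat.
    assert (I : forall u v, ex_RInt (extend0 f) u v).
    { intros u v. apply (@ex_RInt_continuous R_CompleteNormedModule).
      intros z _. apply Hc. }
    rewrite (RInt_extend0 f x), (RInt_extend0 f (a * x)) by lra.
    (* After this substitution both integrals run from 0 to [x], and [RInt_ext] compares integrands
       only at interior points, where [H] applies. *)
    pose proof (RInt_comp_lin (extend0 f) a 0 0 x (I _ _)) as E.
    rewrite Rmult_0_r, !Rplus_0_r in E. rewrite <- E.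
    transitivity (RInt (fun t => scal b (extend0 f t)) 0 x).
    + apply RInt_ext. intros t. rewrite Rmin_left, Rmax_right by lra.
      intros [Ht _]. rewrite Rplus_0_r.
      assert (0 < a * t) by now apply Rmult_lt_0_compat.
      rewrite !extend0_pos by lra. now apply H.
    + apply (RInt_scal (extend0 f) 0 x b), I.
Qed.

Lemma ln_neq_0_of_neq_1 (a : R) : 0 < a -> a <> 1 -> ln a <> 0.
Proof. intros ha ha1 H. apply ha1, ln_inv; [assumption | lra | now rewrite ln_1]. Qed.

Lemma Rpower_Rlog (a x : R) : 0 < a -> a <> 1 -> 0 < x -> Rpower a (Rlog a x) = x.
Proof.
  intros ha ha1 hx. unfold Rpower, Rlog.
  replace (ln x / ln a * ln a) with (ln x)
    by (field; now apply ln_neq_0_of_neq_1).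
  now apply exp_ln.
Qed.

Lemma Rlog_mult_base (a x : R) :
  0 < a -> a <> 1 -> 0 < x -> Rlog a (a * x) = Rlog a x + 1.
Proof.
  intros ha ha1 hx. unfold Rlog. rewrite ln_mult by assumption.
  field. now apply ln_neq_0_of_neq_1.
Qed.

Lemma continuous_Rpower_r (a y : R) : continuous (Rpower a) y.
Proof. apply (@ex_derive_continuous R_AbsRing). unfold Rpower. auto_derive; trivial. Qed.

Lemma continuous_Rpower_l (c x : R) : 0 < x -> continuous (fun t => Rpower t c) x.
Proof. intros. apply (@ex_derive_continuous R_AbsRing). unfold Rpower. now auto_derive. Qed.

Lemma continuous_Rlog (a x : R) : 0 < x -> continuous (Rlog a) x.
Proof. intros. apply (@ex_derive_continuous R_AbsRing). unfold Rlog. now auto_derive. Qed.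

Lemma Galileo_form_of_Galileo (a b : R) (f : R -> R) :
  0 < a -> a <> 1 -> 0 < b -> Galileo a b f -> Galileo_form a b f.
Proof.
  intros ha ha1 hb [Hpos [Hc HI]].
  pose proof (proj1 (RInt_dilation_iff a b f ha Hc) HI) as S.
  set (c := Rlog a (b / a)).
  assert (Hac : Rpower a c = b / a)
    by (apply Rpower_Rlog; trivial; now apply Rdiv_lt_0_compat).
  assert (P : forall y, 0 < Rpower a y) by (intros; apply exp_pos).
  (* Solving the displayed form for [g] at [x = a ^ y] forces this value, since
     [x ^ c = a ^ (c * y)]. *)
  exists (fun y => extend0 f (Rpower a y) * Rpower a (- c * y)).
  split; [| split; [| split]].
  - intros y. apply Rmult_le_pos; [| now apply Rlt_le].
    apply Hpos, Rmax_l.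
  - intros y. apply (continuous_mult (fun y => extend0 f (Rpower a y))).
    + apply (continuous_comp (Rpower a)); [apply continuous_Rpower_r |].
      now apply continuous_extend0.
    + apply (continuous_comp (fun y => - c * y)); [| apply continuous_Rpower_r].
      apply (@ex_derive_continuous R_AbsRing). now auto_derive.
  - intros y. rewrite !extend0_pos by (apply Rlt_le, P).
    rewrite Rpower_plus, (Rpower_1 a ha), (Rmult_comm _ a).
    replace (- c * (y + 1)) with (- c * y + - c) by ring.
    rewrite Rpower_plus, Rpower_Ropp, Hac.
    (* The factor [b / a] gained by [f] cancels against [a ^ (- c) = / (b / a)]. *)
    replace (f (a * Rpower a y)) with (b * f (Rpower a y) / a)
      by (rewrite <- (S _ (P y)); field; lra).
    field. lra.
  - intros x hx. cbv beta. rewrite Rpower_Rlog by assumption.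
    rewrite extend0_pos by lra.
    rewrite Rmult_comm with (r1 := - c), <- Rpower_mult, Rpower_Rlog by assumption.
    rewrite Rmult_assoc, <- Rpower_plus, Rplus_opp_l, Rpower_O by assumption.
    ring.
Qed.

(** [at_right 0] omits the point 0, but any neighbourhood of [f 0] contains [f 0], so adding that
    point costs nothing. *)
Lemma continuous_on_nonneg (f : R -> R) :
  filterlim f (at_right 0) (locally (f 0)) ->
  (forall x, 0 < x -> continuous f x) ->
  continuous_on (fun x => 0 <= x) f.
Proof.
  intros H0 Hc x [Hx | <-].
  - apply (filterlim_filter_le_1 _ (filter_le_within _)), Hc, Hx.
  - intros P HP. generalize (H0 P HP). unfold filtermap, at_right, within.
    apply filter_imp. intros t Ht [Hlt | <-]; [now apply Ht |].
    now apply locally_singleton.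
Qed.

Lemma Galileo_of_Galileo_form (a b : R) (f : R -> R) :
  0 < a -> a <> 1 -> 0 < b -> filterlim f (at_right 0) (locally (f 0)) ->
  Galileo_form a b f -> Galileo a b f.
Proof.
  intros ha ha1 hb H0 [g [Hg [Hgc [Hp Hf]]]].
  set (c := Rlog a (b / a)) in Hf.
  assert (Hac : Rpower a c = b / a)
    by (apply Rpower_Rlog; trivial; now apply Rdiv_lt_0_compat).
  assert (Hpos : forall x, 0 < x -> 0 <= f x).
  { intros x Hx. rewrite Hf by assumption.
    apply Rmult_le_pos; [apply Hg | apply Rlt_le, exp_pos]. }
  assert (Hc : continuous_on (fun x => 0 <= x) f).
  { apply continuous_on_nonneg; [assumption |]. intros x Hx.
    apply (continuous_ext_loc _ (fun x => g (Rlog a x) * Rpower x c)).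
    - apply (filter_imp (fun t => 0 < t)); [| apply (open_gt 0 x Hx)].
      intros t Ht. symmetry. now apply Hf.
    - apply (continuous_mult (fun x => g (Rlog a x))).
      + apply (continuous_comp (Rlog a) g); [now apply continuous_Rlog | apply Hgc].
      + now apply continuous_Rpower_l. }
  split; [| split; [assumption |]].
  - intros x [Hx | <-]; [now apply Hpos |].
    (* The form does not constrain [f 0]; its sign comes from being a limit of nonnegative
       values. *)
    apply (@filterlim_le R (at_right 0) _ (fun _ => 0) f 0 (f 0)).
    + exists posreal_one. intros t _. apply Hpos.
    + apply filterlim_const.
    + exact H0.
  - apply RInt_dilation_iff; trivial. intros x Hx.
    rewrite !Hf by (trivial; now apply Rmult_lt_0_compat).
    (* Dilation by [a] shifts the logarithm by one period of [g] and multiplies the power by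
       [a ^ c = b / a]. *)
    rewrite Rlog_mult_base, Hp, <- Rpower_mult_distr, Hac by assumption.
    field. lra.
Qed.

(* The displayed form says nothing about f at 0; continuity of f there is the
   only part of "f : [0,oo) -> [0,oo) is continuous" that it does not imply,
   and is the hypothesis of the converse. *)
Theorem theorem14 (a b : R) (ha : 0 < a) (ha1 : a <> 1) (hb : 0 < b) :
  (forall f : R -> R, Galileo a b f -> Galileo_form a b f) /\
  (forall f : R -> R, filterlim f (at_right 0) (locally (f 0)) ->
     Galileo_form a b f -> Galileo a b f).
Proof.
  split; intros f.
  - now apply Galileo_form_of_Galileo.
  - now apply Galileo_of_Galileo_form.
Qed.
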